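(* Let $(P_\alpha)_{\alpha\in A}$ be a net of probability measures on $(\mathcal{F},\mathcal{B}_F)$ and let $P$ be a probability measure on $(\mathcal{F},\mathcal{B}_F)$. The following two statements (i) and (ii) are equivalent: (i) $P_\alpha \rightarrow_w P$ on $(\mathcal{F},\tau_{uF})$. (ii) $$\limsup_\alpha P_\alpha\Big(\bigcap_{K \in \mathcal{K}^*} \mathcal{H}(K)\Big) \le P\Big(\bigcap_{K \in \mathcal{K}^*} \mathcal{H}(K)\Big)$$ for every collection $\mathcal{K}^* \subseteq \mathcal{K}$ of compact sets in $E$.
   Context: $(E,\mathcal{G})$ is a non-empty locally compact, second-countable Hausdorff space; $\mathcal{G}$ is the family of its open sets, and $\mathcal{F}$ and $\mathcal{K}$ are the families of all closed and all compact subsets of $E$. For $A\subseteq E$ put $\mathcal{M}(A)=\{F\in\mathcal{F}: F\cap A=\emptyset\}$ and $\mathcal{H}(A)=\{F\in\mathcal{F}: F\cap A\neq\emptyset\}$. The Fell topology $\tau_F$ on $\mathcal{F}$ is generated by $\{\mathcal{M}(K):K\in\mathcal{K}\}\cup\{\mathcal{H}(G):G\in\mathcal{G}\}$; the upper Fell topology $\tau_{uF}$ on $\mathcal{F}$ is generated by $\{\mathcal{M}(K):K\in\mathcal{K}\}$. Their Borel $\sigma$-algebras coincide: $\mathcal{B}_F:=\sigma(\tau_F)=\sigma(\tau_{uF})$. An empty intersection of subsets of $\mathcal{F}$ is $\mathcal{F}$. Weak convergence: for a topological space $(X,\mathcal{O})$ and a net $(P_\alpha)_{\alpha\in A}$ ($A$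 a directed set) of probability measures and a probability measure $P$ on $(X,\sigma(\mathcal{O}))$, $P_\alpha\rightarrow_w P$ on $(X,\mathcal{O})$ means convergence in the weak topology, i.e. the initial topology on the set of probability measures with respect to the maps $P\mapsto P(O)$, $O\in\mathcal{O}$, into $\mathbb{R}$ with the topology $\{(a,\infty):a\in\mathbb{R}\}\cup\{\emptyset,\mathbb{R}\}$. Equivalently: $\liminf_\alpha P_\alpha(O)\ge P(O)$ for all $O\in\mathcal{O}$; equivalently: $\limsup_\alpha P_\alpha(F)\le P(F)$ for all closed sets $F$ of $(X,\mathcal{O})$. *)

(* Defs.v *)
From HB Require Import structures.
From mathcomp Require Import all_boot all_order all_algebra.
From mathcomp Require Import all_classical all_reals all_analysis.

Set Implicit Arguments.
Unset Strict Implicit.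
Unset Printing Implicit Defensive.

Import Order.TTheory GRing.Theory Num.Theory.
Import numFieldNormedType.Exports.

Local Open Scope classical_set_scope.
Local Open Scope ring_scope.

(* A directed set is a non-empty preorder satisfying [directed]. *)
Definition directed d (A : preorderType d) : Prop :=
  forall a b : A, exists c : A, (a <= c)%O /\ (b <= c)%O.

(* The net [x] converges to [l] iff [x @ tails A --> l]. *)
Definition tails d (A : preorderType d) : set_system A :=
  filter_from [set: A] (fun a => [set b | (a <= b)%O]).
Arguments tails {d} A.

Definition net_limsup d (A : preorderType d) (R : realType)
    (x : A -> \bar R) : \bar R :=
  ereal_inf [set ereal_sup [set x b | b in [set b | (a <= b)%O]] | a in [set: A]].

Definition closeds (E : topologicalType) : Type := [set F : set E | closed F].

Section closeds.
Variable E : topologicalType.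

HB.instance Definition _ := Choice.on (closeds E).

Lemma closeds0_subproof : (set0 : set E) \in [set F : set E | closed F].
Proof. by rewrite inE; exact: closed0. Qed.

HB.instance Definition _ :=
  isPointed.Build (closeds E) (exist _ set0 closeds0_subproof).

Definition carrier (F : closeds E) : set E := \val F.

Definition miss (A : set E) : set (closeds E) :=
  [set F | carrier F `&` A = set0].

Definition hit (A : set E) : set (closeds E) :=
  [set F | carrier F `&` A !=set0].

Definition upper_fell_subbase : set (set (closeds E)) :=
  [set miss K | K in [set K | compact K]].

Definition fell_subbase : set (set (closeds E)) :=
  upper_fell_subbase `|` [set hit G | G in [set G | open G]].

Definition upper_fell : Type := closeds E.
HB.instance Definition _ := Pointed.on upper_fell.
HB.instance Definition _ :=
  @isSubBaseTopological.Build upper_fell (set (closeds E)) upper_fell_subbase id.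

Definition fell : Type := closeds E.
HB.instance Definition _ := Pointed.on fell.
HB.instance Definition _ :=
  @isSubBaseTopological.Build fell (set (closeds E)) fell_subbase id.

Definition fell_borel := g_sigma_algebraType (@open fell).
HB.instance Definition _ := Measurable.on fell_borel.

Lemma upper_fell_open_fell (U : set (closeds E)) :
  @open upper_fell U -> @open fell U.
Proof.
move=> [B Bfin <-]; exists B => // V /Bfin [D DS <-].
by exists D => // W /DS; rewrite !inE => ?; left.
Qed.

Lemma upper_fell_open_measurable (U : set (closeds E)) :
  @open upper_fell U -> @measurable _ fell_borel U.
Proof. by move=> /upper_fell_open_fell oU; exact: sub_sigma_algebra. Qed.

End closeds.

Definition lower_real (R : realType) : Type := R.

Section lower_real.
Variable R : realType.

HB.instance Definition _ := Choice.on (lower_real R).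

Definition lower_open : set_system (lower_real R) :=
  [set set0; setT] `|` [set [set x : R | a < x] | a in [set: R]].

Lemma lower_openT_subproof : lower_open setT.
Proof. by left; right. Qed.

Lemma lower_openI_subproof : setI_closed lower_open.
Proof.
move=> A B [[->|->]|[a _ <-]].
- by move=> _; rewrite set0I; left; left.
- by rewrite setTI.
move=> [[->|->]|[b _ <-]].
- by rewrite setI0; left; left.
- by rewrite setIT; right; exists a.
right; exists (Num.max a b) => //; apply/seteqP; split => x /=.
  by rewrite gt_max => /andP.
by move=> [ax bx]; rewrite gt_max ax bx.
Qed.

Lemma lower_open_bigU_subproof (I : Type) (f : I -> set (lower_real R)) :
  (forall i, lower_open (f i)) -> lower_open (\bigcup_i f i).
Proof.
move=> fop; have [[i fiT]|fNT] := pselect (exists i, f i = setT).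
  by left; right; apply/seteqP; split => // x _; exists i => //; rewrite fiT.
pose S : set R := [set a | exists i, f i = [set x : R | a < x]].
have bigE : \bigcup_i f i = [set x : R | exists2 a, S a & a < x].
  apply/seteqP; split => x /= [].
    move=> i _; have [[fi|fi]|[a _ fi]] := fop i; first by rewrite fi.
      by case: fNT; exists i.
    by move=> fix_; exists a; [exists i|move: fix_; rewrite -fi].
  by move=> a [i fi] ax; exists i => //; rewrite fi.
rewrite bigE; have [->|/set0P S0] := eqVneq S set0.
  by left; left; apply/seteqP; split => x // [].
have [lbS|NlbS] := pselect (has_lbound S).
  right; exists (inf S) => //; apply/seteqP; split => x /=.
    by move=> /(inf_lt S0).
  by move=> [a Sa]; apply: le_lt_trans; exact: ge_inf.
left; right; apply/seteqP; split => // x _ /=.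
apply: contrapT => Nx; apply: NlbS; exists x => a Sa.
by rewrite leNgt; apply/negP => ax; apply: Nx; exists a.
Qed.

HB.instance Definition _ := isOpenTopological.Build (lower_real R)
  lower_openT_subproof lower_openI_subproof lower_open_bigU_subproof.

End lower_real.

Section weak_prob.
Context d (T : measurableType d) (R : realType).

Definition prob_eval (U : set T) (P : probability T R) : lower_real R :=
  fine (P U).

(* [tau] is the family of open sets of a topology on [T] contained in the
   sigma-algebra of [T]; [weak_prob tau] is the initial topology with respect to
   the maps [prob_eval U] for [U] in [tau]. *)
Definition weak_prob (tau : set (set T)) : Type :=
  sup_topology (fun U : tau =>
    Topological.class (initial_topology (prob_eval (\val U)))).

HB.instance Definition _ (tau : set (set T)) := Topological.on (weak_prob tau).

Definition weak_cvg (tau : set (set T)) d' (A : preorderType d')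
    (P_ : A -> probability T R) (P : probability T R) : Prop :=
  (P_ : A -> weak_prob tau) @ tails A --> (P : weak_prob tau).

End weak_prob.

(* Main.v *)
Require Import Defs.
From HB Require Import structures.
From mathcomp Require Import all_boot all_order all_algebra finmap.
From mathcomp Require Import all_classical all_reals all_analysis.

Set Implicit Arguments.
Unset Strict Implicit.
Unset Printing Implicit Defensive.

Import Order.TTheory GRing.Theory Num.Theory.
Import numFieldNormedType.Exports.

(** The sets [miss K] with [K] compact are stable under finite intersections,
because [miss K1 `&` miss K2 = miss (K1 `|` K2)] and a finite union of compact
sets is compact; the empty intersection is [miss set0].  Hence this subbase of
the upper Fell topology is already a base, and since [miss K] is the complement
of [hit K], the closed sets of the upper Fell topology are exactly the
intersections [\bigcap_(K in Kstar) hit K] over families [Kstar] of compact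
sets ([open_upper_fellP]).

It remains to see that weak convergence is the limsup condition on these closed
sets.  By definition of the initial topology and of the topology of open upper
half-lines on the reals, weak convergence says that for every open set [U] and
every [c < P U], eventually [c < P_ a U] ([weak_cvgP]).  As all the measures
have total mass one, this is the statement that the limsup of [P_ a (~` U)] is
at most [P (~` U)] ([net_limsup_onemP]). *)

Local Open Scope classical_set_scope.
Local Open Scope ereal_scope.

Lemma tails_filter d (A : preorderType d) :
  [set: A] !=set0 -> directed A -> Filter (tails A).
Proof.
move=> [a0 _] dirA; apply: filter_from_filter; first by exists a0.
move=> a b _ _; have [c [ac bc]] := dirA a b.
by exists c => // x /= cx; split; [apply: le_trans ac cx|apply: le_trans bc cx].
Qed.

(** Convergence for the topology of open upper half-lines: an eventual strict
lower bound for each real number below the limit. *)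
Lemma cvg_lower_realP (R : realType) (F : set_system (lower_real R))
    (l : lower_real R) : Filter F ->
  F --> l <-> (forall c : R, (c < l)%R -> F [set x : R | (c < x)%R]).
Proof.
move=> FF; split=> [Fl c cl|Fl U].
  apply: Fl; apply: open_nbhs_nbhs; split=> //.
  by right; exists c.
rewrite /= nbhsE => -[V [oV Vl] VU].
apply: filterS VU _; case: oV Vl => [[->//|->_]|[c _ <-] /= cl].
  exact: filterT.
exact: Fl.
Qed.

(** Unlike [cvg_image], this does not require [f] to be surjective. *)
Lemma cvg_initialP (S : choiceType) (T : topologicalType) (f : S -> T)
    (F : set_system S) (s : S) : Filter F ->
  F --> (s : initial_topology f) <-> f @ F --> f s.
Proof.
move=> FF; split=> [Fs|Ffs U].
  exact: (cvg_comp _ _ Fs (@initial_continuous _ _ f s)).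
move=> [_ [[B oB <-] Bfs sBU]]; apply: filterS sBU _.
by apply: Ffs; exact: open_nbhs_nbhs.
Qed.

(** Weak convergence of a net, in the form liminf P_a(U) >= P(U) for [U] in
[tau]. *)
Lemma weak_cvgP dT (T : measurableType dT) (R : realType) (tau : set (set T))
    d (A : preorderType d) (P_ : A -> probability T R) (P : probability T R) :
  [set: A] !=set0 -> directed A ->
  weak_cvg tau P_ P <->
  (forall U, tau U -> forall c : R, (c < fine (P U))%R ->
     exists a, forall b, (a <= b)%O -> (c < fine (P_ b U))%R).
Proof.
move=> A0 dirA; have FA := tails_filter A0 dirA.
rewrite /weak_cvg; split.
  move=> /cvg_sup PP U tauU.
  have /cvg_initialP/cvg_lower_realP PU := PP (exist _ U (mem_set tauU)).
  by move=> c /PU [a _ aP]; exists a => b ab; exact: aP.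
move=> PU; apply/cvg_sup => -[U tauU].
apply/cvg_initialP/cvg_lower_realP => c cP.
by have [a aP] := PU U (set_mem tauU) c cP; exists a.
Qed.

(** Passing to complements turns limsup upper bounds into liminf lower bounds. *)
Lemma net_limsup_onemP d (A : preorderType d) (R : realType) (x : A -> R)
    (l : R) :
  net_limsup (fun a => 1 - (x a)%:E) <= 1 - l%:E <->
  (forall c : R, (c < l)%R ->
     exists a, forall b, (a <= b)%O -> (c < x b)%R).
Proof.
split=> [xl c cl|xl].
  have /ereal_inf_lt [_ [a _ <-] supa] :
      net_limsup (fun a => 1 - (x a)%:E) < 1 - c%:E.
    by apply: le_lt_trans xl _; rewrite -!EFinB lte_fin ltrD2l ltrN2.
  exists a => b ab; have : 1 - (x b)%:E < 1 - c%:E.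
    by apply: le_lt_trans supa; apply: ereal_sup_ubound; exists b.
  by rewrite -!EFinB lte_fin ltrD2l ltrN2.
apply/lee_addgt0Pr => e e0.
have [a aP] := xl (l - e)%R ltac:(by rewrite ltrBlDr ltrDl).
apply: ge_ereal_inf; eexists; first by exists a.
apply: ge_ereal_sup => _ [b /aP lexb <-].
by rewrite -!EFinB -EFinD lee_fin -addrA lerD2l lerNl opprD opprK ltW.
Qed.

Lemma hitC (E : topologicalType) (K : set E) : ~` hit K = miss K.
Proof.
apply/seteqP; split=> F; rewrite /hit /miss /=; last by move=> -> [].
by move=> FK; apply: contrapT => /eqP/set0P.
Qed.

Lemma miss_bigcup (E : topologicalType) (I : Type) (D : set I)
    (K : I -> set E) :
  miss (\bigcup_(i in D) K i) = \bigcap_(i in D) miss (K i).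
Proof.
rewrite -hitC; under eq_bigcapr do rewrite -hitC.
rewrite -setC_bigcup; congr (~` _); apply/seteqP; split=> F /=.
  by move=> [x [Fx [i Di Kx]]]; exists i => //; exists x.
by move=> [i Di [x [Fx Kx]]]; exists x; split=> //; exists i.
Qed.

Lemma open_miss (E : topologicalType) (K : set E) :
  compact K -> @open (upper_fell E) (miss K).
Proof.
move=> cK; exists [set miss K]; last by rewrite bigcup_set1.
by move=> _ ->; apply: finI_from1; exists K.
Qed.

(** The subbase of the upper Fell topology is stable under finite
intersections, including the empty one. *)
Lemma finI_upper_fell_subbase (E : topologicalType) (V : set (closeds E)) :
  finI_from (@upper_fell_subbase E) id V ->
  exists2 K, compact K & miss K = V.
Proof.
move=> [D Dmiss <-].
have /choice [K KP] (W : set (closeds E)) : exists K : set E,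
    W \in D -> compact K /\ miss K = W.
  have [/Dmiss|] := boolP (W \in D); last by exists set0.
  by rewrite inE => -[K cK KW]; exists K.
exists (\bigcup_(W in [set` D]) K W).
  rewrite bigcup_fset big_seq; apply: bigsetU_compact => W WD.
  exact: (KP W WD).1.
rewrite miss_bigcup; apply: eq_bigcapr => W WD.
exact: (KP W WD).2.
Qed.

(** The closed sets of the upper Fell topology are the intersections of sets
[hit K] with [K] compact. *)
Lemma open_upper_fellP (E : topologicalType) (U : set (closeds E)) :
  @open (upper_fell E) U <->
  exists2 Kstar : set (set E), Kstar `<=` [set K | compact K] &
    ~` (\bigcap_(K in Kstar) hit K) = U.
Proof.
split=> [[B Bfin <-]|[Kstar Kcpt <-]]; last first.
  rewrite setC_bigcap; apply: (@bigcup_open (upper_fell E)) => K /Kcpt cK.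
  by rewrite hitC; exact: open_miss.
exists [set K | compact K /\ B (miss K)]; first by move=> K [].
rewrite setC_bigcap; under eq_bigcupr do rewrite hitC.
apply/seteqP; split=> F [].
  by move=> K [_ BK] FK; exists (miss K).
move=> V BV FV; have [K cK KV] := finI_upper_fell_subbase (Bfin _ BV).
by exists K; [split=> //; rewrite KV|rewrite KV].
Qed.

Theorem proposition1 (R : realType) (E : topologicalType)
    (E_nonempty : [set: E] !=set0)
    (E_locally_compact : locally_compact [set: E])
    (E_second_countable : @second_countable E)
    (E_hausdorff : hausdorff_space E)
    (d : Order.disp_t) (A : preorderType d)
    (A_nonempty : [set: A] !=set0) (A_directed : directed A)
    (P_ : A -> probability (fell_borel E) R) (P : probability (fell_borel E) R) :
  weak_cvg (T := fell_borel E) (@open (upper_fell E)) P_ P <->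
  (forall Kstar : set (set E), Kstar `<=` [set K | compact K] ->
     net_limsup (fun a => P_ a (\bigcap_(K in Kstar) hit K)) <=
     P (\bigcap_(K in Kstar) hit K)).
Proof.
have PE (Q : probability (fell_borel E) R) (C : set (closeds E)) :
    @open (upper_fell E) (~` C) -> Q C = 1 - (fine (Q (~` C)))%:E.
  move=> oC; have mC := upper_fell_open_measurable oC.
  rewrite -{1}(setCK C) (@probability_setC _ (fell_borel E) _ Q)//.
  by rewrite fineK// (@fin_num_measure _ (fell_borel E) _ Q).
(* The previous identity expresses the measures of the closed set [C] through
   those of its open complement. *)
have limsupP (C : set (closeds E)) : @open (upper_fell E) (~` C) ->
    net_limsup (fun a => P_ a C) <= P C <->
    (forall c : R, (c < fine (P (~` C)))%R ->
      exists a, forall b, (a <= b)%O -> (c < fine (P_ b (~` C)))%R).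
  move=> oC; rewrite (PE P)//; under [X in net_limsup X]funext do rewrite PE//.
  exact: net_limsup_onemP.
rewrite weak_cvgP//; split=> [PU Kstar Kcpt|PK U].
  have oK : @open (upper_fell E) (~` (\bigcap_(K in Kstar) hit K)).
    by apply/open_upper_fellP; exists Kstar.
  by apply/limsupP => //; exact: PU.
move=> oU; have [Kstar Kcpt KU] := (open_upper_fellP U).1 oU.
by rewrite -KU in oU *; apply/limsupP => //; exact: PK.
Qed.
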